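(* Let $n\ge 1$. Each of the following two sets of signed permutations is in descent preserving bijection with the set of all standard domino tableaux of shapes $(a,2n-a)$, where $a$ ranges over the integers with $a\ge 2n-a\ge 2$: \begin{itemize} \item the set of type 5 signed arc permutations, $\bigcup_{1\le k\le n-1}\{\,-k\;\,-(k-1)\;\dots\;-1\ \sqcup\!\sqcup\ k+1\;\dots\;n\,\}$; \item the set of type 6 signed arc permutations, $\bigcup_{1\le k\le n-1}\{\,-n\;\dots\;-(k+1)\ \sqcup\!\sqcup\ 1\;\dots\;k\,\}$. \end{itemize}
   Context: $B_n$ is the hyperoctahedral group of all permutations $\pi$ of $\{-n,\dots,-1,0,1,\dots,n\}$ with $\pi(-i)=-\pi(i)$ for all $i$; $\pi$ is identified with the word $\pi(1)\cdots\pi(n)$. For $\pi\in B_n$, $Des(\pi)=\{0\le i\le n-1 \mid \pi(i)>\pi(i+1)\}$ (with $\pi(0)=0$). For two sequences $\alpha,\beta$, $\alpha\sqcup\!\sqcup\beta$ is the set of all sequences obtained by interleaving the letters of $\alpha$ and $\beta$ preserving the order of the letters of $\alpha$ and of $\beta$. Young diagrams are drawn with left-justified rows, row 1 on top. A standard domino tableau of shape $\lambda$, $\lambda$ a partition of $2n$, is a tiling of the Young diagram of $\lambda$ by $n$ dominoes ($1\times 2$ or $2\times 1$ rectangles) labelled bijectively by $\{1,\dots,n\}$, labels strictly increasing along rows and down columns (comparing distinct dominoes). A standard domino tableau $T$ has a descent in position $i$, $1\le i\le n-1$, if the domino labelled $i+1$ lies strictly below the domino labelled $i$ (all boxes of domino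 $i+1$ lie in rows strictly lower than all boxes of domino $i$), and has a descent in position $0$ if the domino labelled $1$ is vertical; $Des(T)$ is the set of its descents. A bijection $f$ from a set of signed permutations to a set of standard domino tableaux is descent preserving if $Des(f(\pi))=Des(\pi)$ for all $\pi$. *)

(* Defs.v *)
From mathcomp Require Import all_boot all_order all_algebra all_fingroup.

Set Implicit Arguments.
Unset Strict Implicit.
Unset Printing Implicit Defensive.

Import GRing.Theory Num.Theory.

(* The ordinal i : 'I_(2n+1) stands for the integer i - n in {-n, ..., n}; *)
(* under this encoding negation is rev_ord.                                *)
Notation symm_perm n := {perm 'I_n.*2.+1}.

Definition hyperoct (n : nat) : {set symm_perm n} :=
  [set p : symm_perm n | [forall i, p (rev_ord i) == rev_ord (p i)]].

(* The integer p(i), for 0 <= i <= n. *)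
Definition sval_at (n : nat) (p : symm_perm n) (i : nat) : int :=
  (Posz (p (inord (n + i))) - Posz n)%R.

Definition word (n : nat) (p : symm_perm n) : seq int :=
  [seq sval_at p i | i <- iota 1 n].

Definition des_perm (n : nat) (p : symm_perm n) : {set 'I_n} :=
  [set i : 'I_n | (sval_at p i.+1 < sval_at p i)%R].

(* The mask m marks the positions of w filled by the letters of a. *)
Definition shuffle (T : eqType) (a b : seq T) : pred (seq T) :=
  fun w => [exists m : (size w).-tuple bool,
              (mask m w == a) && (mask (map negb m) w == b)].

(* -j ... -i *)
Definition neg_run (i j : nat) : seq int :=
  [seq (- Posz x)%R | x <- rev (index_iota i j.+1)].

(* i ... j *)
Definition pos_run (i j : nat) : seq int :=
  [seq Posz x | x <- index_iota i j.+1].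

Definition type5_arc (n : nat) : {set symm_perm n} :=
  [set p in hyperoct n | [exists k : 'I_n,
     (1 <= k) && shuffle (neg_run 1 k) (pos_run k.+1 n) (word p)]].

Definition type6_arc (n : nat) : {set symm_perm n} :=
  [set p in hyperoct n | [exists k : 'I_n,
     (1 <= k) && shuffle (neg_run k.+1 n) (pos_run 1 k) (word p)]].

(* Boxes are pairs (row, column), both counted from 0, row 0 on top. *)
Definition box := (nat * nat)%type.

Definition is_partition_of (m : nat) (sh : seq nat) : bool :=
  [&& sorted geq sh, 0 \notin sh & sumn sh == m].

Definition young_diagram (sh : seq nat) : seq box :=
  [seq (r, c) | r <- iota 0 (size sh), c <- iota 0 (nth 0 sh r)].

(* A domino is its topmost leftmost box together with a boolean telling *)
(* whether it is vertical.                                              *)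
Definition domino := (box * bool)%type.

Definition vertical (d : domino) : bool := d.2.

Definition boxes (d : domino) : seq box :=
  let: ((r, c), v) := d in
  [:: (r, c); if v then (r.+1, c) else (r, c.+1)].

Definition left_or_above (x y : box) : bool :=
  ((x.1 == y.1) && (x.2 < y.2)) || ((x.2 == y.2) && (x.1 < y.1)).

Definition strictly_below (d e : domino) : bool :=
  all (fun x : box => all (fun y : box => y.1 < x.1) (boxes e)) (boxes d).

(* In a labelled family T of n dominoes, the label l (1 <= l <= n) is borne *)
(* by the entry of index l - 1.                                             *)
Definition labelled (n : nat) (T : n.-tuple domino) (l : nat) : domino :=
  nth (0, 0, false) T l.-1.

(* As young_diagram sh has no repetition, the perm_eq condition says that *)
(* the dominoes are pairwise disjoint and cover exactly the diagram.      *)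
Definition std_domino_tableau (n : nat) (sh : seq nat) (T : n.-tuple domino) :
    bool :=
  [&& is_partition_of n.*2 sh,
      perm_eq (flatten [seq boxes d | d <- T]) (young_diagram sh)
    & [forall i : 'I_n, forall j : 'I_n,
         (i != j) && has (fun x => has (left_or_above x) (boxes (tnth T j)))
                         (boxes (tnth T i)) ==> (i < j)]].

Definition des_tab (n : nat) (T : n.-tuple domino) : {set 'I_n} :=
  [set i : 'I_n | if i == 0 :> nat then vertical (labelled T 1)
                  else strictly_below (labelled T i.+1) (labelled T i)].

(* The bound on the bound variable a is implied by the other conditions. *)
Definition two_row_tableau (n : nat) (T : n.-tuple domino) : bool :=
  [exists a : 'I_n.*2.+1, [&& n.*2 - a <= a, 2 <= n.*2 - a
     & std_domino_tableau [:: nat_of_ord a; n.*2 - a] T]].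

Definition descent_preserving_bijection (n : nat) (A : {set symm_perm n})
    (B : pred (n.-tuple domino)) : Prop :=
  exists f : {p | p \in A} -> {T | B T},
    bijective f /\ forall p, des_tab (val (f p)) = des_perm (val p).

(* Main.v *)
(* Both sides are encoded by words of n bits. On the permutation side bit i   *)
(* tells whether the i-th letter is negative; as each of the two shuffled     *)
(* words is increasing, i is a descent iff bit i is 0 and bit i+1 is 1, with  *)
(* bit 0 equal to 0, and the bit words obtained are the nonconstant ones. On  *)
(* the tableau side a two-row tableau grows one domino at a time, and there   *)
(* are always two ways to continue: a horizontal domino in row 0 (bit 0), or  *)
(* the only other possibility (bit 1), namely a vertical domino if both rows  *)
(* have the same length and a horizontal domino in row 1 otherwise. Descents  *)
(* are read off the bits by the same rule, but the bit words excluded by the  *)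
(* shape condition are 00...0 and 10...0 rather than 00...0 and 11...1; the   *)
(* last two words have the same descents, so exchanging them is harmless.     *)
Require Import Defs.
From mathcomp Require Import all_boot all_order all_algebra all_fingroup.
From mathcomp Require Import zify.

Set Implicit Arguments.
Unset Strict Implicit.
Unset Printing Implicit Defensive.

Import Order.TTheory GRing.Theory Num.Theory.

(** Injective codes with a common image match the objects ([bijection_by_code]), and descents are a
    function of the code ([bit_descents]). An arc permutation is recovered from its signs: the
    number of negative letters gives k, and each of the two runs then fills its places in order;
    every nonconstant sign word arises ([shuffles_bijection]).

    A tableau is recovered from its bits because the dominoes with labels at most i tile a two-row
    diagram and the next domino has to sit on its boundary ([dominoes_of_bits]). Conversely every
    bit word grows a standard tableau ([dominoes_of_young2], [dominoes_of_pairwise]), whose lower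
    row is long enough exactly under the condition of [rows_of_ge2]. [head_to_full] reconciles the
    two sets of words. *)

Lemma bijection_by_code (S T : choiceType) (K : eqType) (A : pred S)
    (B : pred T) (c : S -> K) (d : T -> K) :
  {in A &, injective c} -> {in B &, injective d} ->
  (forall x, A x -> exists2 y, B y & d y = c x) ->
  (forall y, B y -> exists2 x, A x & c x = d y) ->
  exists f : {x | A x} -> {y | B y},
    bijective f /\ forall x, d (val (f x)) = c (val x).
Proof.
move=> injc injd cd dc.
pose F (x : {x | A x}) := sig2_eqW (cd _ (valP x)).
pose G (y : {y | B y}) := sig2_eqW (dc _ (valP y)).
pose f x : {y | B y} := exist B (s2val (F x)) (s2valP (F x)).
pose g y : {x | A x} := exist A (s2val (G y)) (s2valP (G y)).
have fE x : d (val (f x)) = c (val x) by exact: s2valP' (F x).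
have gE y : c (val (g y)) = d (val y) by exact: s2valP' (G y).
exists f; split=> //; exists g => [x|y]; apply/val_inj.
  by apply: injc; rewrite ?unfold_in ?(valP _) // gE fE.
by apply: injd; rewrite ?unfold_in ?(valP _) // fE gE.
Qed.

(** * Bit words and their descents *)

(** The [false] put in front stands for the letter 0 at position 0, so position 0 is a descent
    exactly when the first bit is 1. *)
Definition bit_descents (n : nat) (m : seq bool) : {set 'I_n} :=
  [set i : 'I_n | ~~ nth false (false :: m) i && nth false m i].

Definition nonconstant (m : seq bool) : bool := has id m && ~~ all id m.

(* A bijection from the nonconstant words to those with a bit 1 outside the *)
(* head, which keeps the descents.                                          *)
Definition head_to_full (m : seq bool) : seq bool :=
  if m == true :: nseq (size m).-1 false then nseq (size m) true else m.

Lemma size_head_to_full m : size (head_to_full m) = size m.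
Proof. by rewrite /head_to_full; case: ifP; rewrite ?size_nseq. Qed.

Lemma has_id_nseq m : ~~ has id m -> m = nseq (size m) false.
Proof. by elim: m => //= -[] //= m IH /IH <-. Qed.

Lemma all_id_nseq m : all id m -> m = nseq (size m) true.
Proof. by elim: m => //= -[] //= m IH /IH <-. Qed.

Lemma head_to_full_inj : {in nonconstant &, injective head_to_full}.
Proof.
have full m m' : nonconstant m' -> nseq (size m) true = m' -> False.
  by case/andP=> _ /negP nall e; case: nall; rewrite -e all_nseq orbT.
move=> m m'; rewrite !unfold_in => ncm ncm' e.
have es : size m = size m' by rewrite -size_head_to_full e size_head_to_full.
move: e; rewrite /head_to_full.
case: ifP => [/eqP em|_]; case: ifP => [/eqP em'|_] //.
- by rewrite em em' es.
- by move/full; case/(_ ncm').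
- by move/esym/full; case/(_ ncm).
Qed.

Lemma has_behead_head_to_full m :
  nonconstant m -> has id (behead (head_to_full m)).
Proof.
rewrite /head_to_full; case: ifP => [/eqP|]; case: m => [|x m] //=.
  case=> -> em; case: m em => [|y m] //= _.
rewrite /nonconstant /=; case: x => //= ne; last by case/andP.
move=> _; apply/negPn/negP => /has_id_nseq em.
by rewrite em size_nseq eqxx in ne.
Qed.

Lemma head_to_full_onto m : has id (behead m) ->
  exists2 m', nonconstant m' & head_to_full m' = m.
Proof.
case: m => [|x m] //= hm; have [/all_id_nseq em|nall]
  := boolP (all id (x :: m)).
  exists (true :: nseq (size m) false).
    rewrite /nonconstant /= all_nseq /= orbF.
    by case: m hm {em}.
  by rewrite /head_to_full /= size_nseq eqxx em.
exists (x :: m); first by rewrite /nonconstant nall /= hm orbT.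
rewrite /head_to_full; case: ifP => //= /eqP[_ em]; move: hm.
by rewrite em has_nseq andbF.
Qed.

Lemma bit_descents_head_to_full n m :
  size m = n -> bit_descents n (head_to_full m) = bit_descents n m.
Proof.
case: m => [|x m] //= sz; rewrite /head_to_full.
case: ifP => //= /eqP ->; apply/setP=> i; rewrite !inE.
case: i => -[|[|i]] //= lt_in; rewrite !nth_nseq ?andbF; 
have ->: i < size m by lia.
by case: ifP.
Qed.

(** * Shuffles read through a mask *)

(* The letters of one of the shuffled words satisfy [P], those of the other *)
(* do not, so the mask of a shuffle can be read off its letters.            *)
Lemma shuffle_filter (T : eqType) (P : pred T) (a b w : seq T) :
    all P a -> all (predC P) b ->
  shuffle a b w = (filter P w == a) && (filter (predC P) w == b).
Proof.
move=> Pa Pb;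
  apply/existsP/andP => [[[m /= sm] /andP[/eqP ea /eqP eb]]|[ea eb]].
  suff em : m = map P w.
    by rewrite -{1}ea -{1}eb em -map_comp -!filter_mask !eqxx.
  move/eqP: sm Pa Pb; rewrite -{}ea -{}eb.
  elim: w m => [|x w IH] [|y m] //= [/IH {}IH].
  by case: y => /= [/andP[-> /IH{}IH] /IH ->|/IH{}IH /andP[/negbTE-> /IH ->]].
exists (map_tuple P (in_tuple w)).
by rewrite /= -map_comp -!filter_mask ea eb.
Qed.

Lemma map_filter_inj (T : eqType) (P : pred T) (w w' : seq T) :
  map P w = map P w' -> filter P w = filter P w' ->
  filter (predC P) w = filter (predC P) w' -> w = w'.
Proof.
elim: w w' => [|x w IH] [|y w'] //= [e em].
by rewrite -e; case: (P x) => /= -[] => [-> /IH{}IH /IH->//|/IH{}IH [-> /IH->]].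
Qed.

Lemma merge_by_mask (T : eqType) (P : pred T) (m : seq bool) (a b : seq T) :
    all P a -> all (predC P) b -> size a = count id m ->
    size b = count negb m ->
  exists w, [/\ map P w = m, filter P w = a & filter (predC P) w = b].
Proof.
elim: m a b => [|[] m IH] a b.
- by case: a b => [|//] [|//]; exists nil.
- case: a => //= x a /andP[Px Pa] Pb [sa] sb.
  by have [w [em ea eb]] := IH a b Pa Pb sa sb; exists (x :: w);
    rewrite /= Px em ea eb.
- case: b => //= x b Pa /andP[/= nPx Pb] sa [sb].
  have [w [em ea eb]] := IH a b Pa Pb sa sb.
  by exists (x :: w); rewrite /= (negbTE nPx) em ea eb.
Qed.

(** Neighbours of [w] in the same class remain neighbours after filtering. *)
Lemma sorted_filter_same (T : Type) (P : pred T) (r : rel T) (w : seq T) :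
  transitive r -> sorted r (filter P w) -> sorted r (filter (predC P) w) ->
  sorted [rel x y | (P x == P y) ==> r x y] w.
Proof.
move=> tr; elim: w => [|x w IH] //= sP snP.
have {}IH : sorted [rel x y | (P x == P y) ==> r x y] w.
  by apply: IH; [move: sP | move: snP]; case: (P x) => //= /path_sorted.
case: w IH sP snP => [|y w] //= -> /=; rewrite andbT.
by case: (P x); case: (P y) => //=; [case/andP | move=> _; case/andP].
Qed.

(** * Two-row domino tableaux as bit words *)

(* In the next definitions [a] and [b] are the current lengths of rows 0 and 1 *)
(* and [x], [m] are the bits telling how the tableau grows.                    *)
Definition next_domino (a b : nat) (x : bool) : domino :=
  if ~~ x then ((0, a), false) else if a == b then ((0, a), true)
  else ((1, b), false).

Definition next_rows (a b : nat) (x : bool) : nat * nat :=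
  if ~~ x then (a.+2, b) else if a == b then (a.+1, b.+1) else (a, b.+2).

Fixpoint dominoes_of (a b : nat) (m : seq bool) : seq domino :=
  if m is x :: m' then
    let: (a', b') := next_rows a b x in
    next_domino a b x :: dominoes_of a' b' m'
  else [::].

Fixpoint rows_of (a b : nat) (m : seq bool) : nat * nat :=
  if m is x :: m' then
    let: (a', b') := next_rows a b x in rows_of a' b' m'
  else (a, b).

(** Reads the growth bit off the domino alone, without the row lengths: bit 0 means horizontal in
    row 0. *)
Definition domino_bit (d : domino) : bool := d.2 || (d.1.1 != 0).

Definition no_box_before (d e : domino) : bool :=
  ~~ has (fun x => has (left_or_above x) (boxes d)) (boxes e).

Lemma mem_young2 a b (x : box) :
  (x \in young_diagram [:: a; b]) =
    ((x.1 == 0) && (x.2 < a)) || ((x.1 == 1) && (x.2 < b)).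
Proof.
apply/allpairsPdep/idP => [[r [c [/= ]]]|].
  by rewrite !mem_iota => hr hc ->; case: r hr hc => [|[|r]] //= _ ->.
by case: x => r c /= /orP[] /andP[/eqP-> hc]; [exists 0, c | exists 1, c];
  by split; rewrite // !mem_iota.
Qed.

Lemma uniq_young sh : uniq (young_diagram sh).
Proof.
apply: allpairs_uniq_dep => [|r _|]; rewrite ?iota_uniq //.
by case=> r c [r' c'] _ _ /= [-> ->].
Qed.

Lemma young2_next a b x (ab := next_rows a b x) : b <= a ->
  perm_eq (boxes (next_domino a b x) ++ young_diagram [:: a; b])
          (young_diagram [:: ab.1; ab.2]).
Proof.
move=> leba; apply: uniq_perm; rewrite ?uniq_young //.
  rewrite cat_uniq uniq_young andbT; apply/andP; split.
    by rewrite /next_domino; case: x ab => //= _; case: (a =P b) => //= _;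
      rewrite inE xpair_eqE; lia.
  apply/hasPn => -[r c]; rewrite mem_young2 /next_domino /=.
  by case: x ab => [|] _ /=; [case: (a =P b) => /= _|]; rewrite !inE !xpair_eqE;
    lia.
case=> r c; rewrite mem_cat !mem_young2 {}/ab /next_domino /next_rows.
by case: x => [|] /=; [case: (a =P b) => /= ?|]; rewrite !inE !xpair_eqE; lia.
Qed.

(** The even difference is an invariant of growth: when the rows differ, row 1 has room for two more
    boxes, so the shape stays a partition. *)
Lemma dominoes_of_young2 a b m (ab := rows_of a b m) :
    b <= a -> ~~ odd (a - b) ->
  [/\ ab.2 <= ab.1, b <= ab.2, ab.1 + ab.2 = a + b + (size m).*2 &
   perm_eq (flatten (map boxes (dominoes_of a b m)) ++ young_diagram [:: a; b])
           (young_diagram [:: ab.1; ab.2])].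
Proof.
rewrite {}/ab; elim: m a b => [|x m IH] a b leba ev /=; first by split=> //;
  rewrite addn0.
have := young2_next x leba.
have /= := IH (next_rows a b x).1 (next_rows a b x).2.
case E: (next_rows a b x) => [a' b'] /=; move=> {}IH pE.
have [le' ev' leb' sum'] : [/\ b' <= a', ~~ odd (a' - b'), b <= b' &
    a' + b' = a + b + 2].
  move: E; rewrite /next_rows; case: x {pE} => /=; last by move=> [<- <-];
    split; lia.
  by case: (a =P b) => [eab|neab] [<- <-]; split; lia.
have [h1 h2 h3 h4] := IH le' ev'; split; [by []|lia|lia|].
apply: perm_trans h4; rewrite -catA perm_catCA.
by rewrite perm_cat2l.
Qed.

Lemma young_left_or_above a b x y : b <= a -> left_or_above x y ->
  y \in young_diagram [:: a; b] -> x \in young_diagram [:: a; b].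
Proof. by case: x y => [r c] [r' c']; rewrite !mem_young2 /left_or_above /=;
  lia. Qed.

Lemma next_rows_cases a b x : b <= a -> ~~ odd (a - b) ->
  (next_rows a b x).2 <= (next_rows a b x).1 /\
  ~~ odd ((next_rows a b x).1 - (next_rows a b x).2).
Proof. by rewrite /next_rows; case: x => /= *; [case: (a =P b) => ?|];
  split=> /=; lia. Qed.

(** Each intermediate diagram is closed under going left or up and is disjoint from all later
    dominoes, so no later box precedes a box already placed. *)
Lemma dominoes_of_pairwise a b m : b <= a -> ~~ odd (a - b) ->
  pairwise no_box_before (dominoes_of a b m).
Proof.
elim: m a b => [|x m IH] a b leba ev //=.
have [] := next_rows_cases x leba ev; have := young2_next x leba.
case: (next_rows a b x) => [a' b'] /= pE le' ev'.
rewrite IH // andbT; apply/allP => e he; apply/hasPn => y hy;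
  apply/hasPn => z hz.
have [_ _ _ /perm_uniq] := dominoes_of_young2 m le' ev'.
rewrite uniq_young cat_uniq => /and3P[_ /hasPn dis _].
apply/negP => lyz.
have yD : y \in young_diagram [:: a'; b'].
  by apply: (young_left_or_above le' lyz); rewrite -(perm_mem pE) mem_cat hz.
by have /negP := dis _ yD; apply; apply/flattenP; exists (boxes e) => //;
  exact: map_f.
Qed.

(** Every box left of or above the first domino lies in that domino or in the current diagram, which
    leaves only the moves of [next_domino]. *)
Lemma dominoes_of_bits a b s A B : b <= a -> B <= A ->
    perm_eq (flatten (map boxes s) ++ young_diagram [:: a; b])
            (young_diagram [:: A; B]) ->
    pairwise no_box_before s ->
  s = dominoes_of a b (map domino_bit s) /\
  (A, B) = rows_of a b (map domino_bit s).
Proof.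
move=> + leBA; elim: s a b => [|d s IH] a b leba /=.
  move=> pE _; split=> //; congr pair.
    (* Equal diagrams have equal rows: otherwise the first box past the shorter row would lie in
       only one of them. *)
    have := perm_mem pE (0, A); have := perm_mem pE (0, a).
    by rewrite !mem_young2 /=; lia.
  have := perm_mem pE (1, B); have := perm_mem pE (1, b).
  by rewrite !mem_young2 /=; lia.
move=> pE /andP[/allP hd ps].
have inAB x : x \in boxes d -> x \in young_diagram [:: A; B].
  by move=> hx; rewrite -(perm_mem pE) !mem_cat hx.
have notin x : x \in boxes d -> x \notin young_diagram [:: a; b].
  move=> hx; apply/negP => hx'; have := perm_uniq pE; rewrite uniq_young.
  by rewrite cat_uniq => /and3P[_ /hasPn/(_ x hx')]; rewrite mem_cat hx.
have before x y : y \in boxes d -> left_or_above x y ->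
    (x \in boxes d) || (x \in young_diagram [:: a; b]).
  move=> hy lxy; have : x \in young_diagram [:: A; B].
    exact: young_left_or_above lxy (inAB _ hy).
  rewrite -(perm_mem pE) !mem_cat => /orP[/orP[->//|]|->]; last by rewrite orbT.
  case/flattenP => _ /mapP[e he ->] hx; have /hasPn/(_ x hx)/hasPn/(_ y hy)
    := hd _ he.
  by rewrite lxy.
have [dE leba'] : d = next_domino a b (domino_bit d) /\
    (next_rows a b (domino_bit d)).2 <= (next_rows a b (domino_bit d)).1.
  clear - leba inAB notin before.
  case: d inAB notin before => [[r c] v] inAB notin before.
  have mem1 : (r, c) \in boxes (r, c, v) by rewrite inE eqxx.
  have mem2 : (if v then (r.+1, c) else (r, c.+1)) \in boxes (r, c, v).
    by rewrite !inE eqxx orbT.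
  have := inAB _ mem1; have := inAB _ mem2; have := notin _ mem1.
  have := notin _ mem2.
  (* The test boxes are the ends of the rows and the boxes above the domino; they suffice to force
     its position. *)
  have := before (0, b) _ mem1; have := before (0, a) _ mem1.
  have := before (0, a) _ mem2; have := before (1, b) _ mem2.
  have := before (0, c) _ mem1; have := before (0, c.+1) _ mem2; have
    := before (1, b) _ mem1.
  rewrite /next_domino /next_rows /domino_bit /left_or_above.
  case: v {inAB notin before mem1 mem2} => /=;
    rewrite !inE !mem_young2 /= !xpair_eqE.
    move=> *; have [-> -> ->] : [/\ r = 0, c = a & a = b] by split; lia.
    by rewrite eqxx /=.
  case: r => [|[|r]] /= *; last by lia.
    by split; [congr (_, _, _)|]; lia.
  by case: (a =P b) => ?; split; rewrite /=; try congr (_, _, _); lia.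
have pN := young2_next (domino_bit d) leba.
rewrite -dE in pN; move: IH; move/(_ _ _ leba').
case: (next_rows a b (domino_bit d)) pN {leba'} => [a' b'] /= pN IH.
have [|<- ->] := IH _ ps; last by rewrite -dE.
apply: perm_trans pE; rewrite -catA perm_sym perm_catCA perm_cat2l.
exact: pN.
Qed.
Lemma map_domino_bit a b m : map domino_bit (dominoes_of a b m) = m.
Proof.
elim: m a b => [|x m IH] a b //=; case: (next_rows a b x) => a' b' /=.
by rewrite IH /next_domino; case: x => //=; case: ifP.
Qed.

Lemma rows_of_ge a b m : b <= (rows_of a b m).2.
Proof.
elim: m a b => [|x m IH] a b //=.
case E: (next_rows a b x) => [a' b']; apply: leq_trans (IH a' b').
by move: E; rewrite /next_rows; case: x => [|[_ <-]] //=; case: ifP => _ [_ <-];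
  lia.
Qed.

(** The first bit 1 lengthens row 1 by one box if the rows are equal and by two if row 0 is longer;
    bits 0 before it only lengthen row 0. *)
Lemma rows_of_gt a b m : has id m -> b + (b < a) < (rows_of a b m).2.
Proof.
elim: m a b => [|x m IH] a b //=; rewrite /next_rows; case: x => /= hm.
  case: (a =P b) => ?; apply: leq_trans (rows_of_ge _ _ _); lia.
by apply: leq_ltn_trans (IH a.+2 b hm); lia.
Qed.

Lemma rows_of_id a b m : ~~ has id m -> (rows_of a b m).2 = b.
Proof. by elim: m a b => [|[] m IH] a b //= /IH. Qed.

(** A bit 1 at the head gives only a vertical domino, hence one box in row 1; the second box needs a
    later bit 1. *)
Lemma rows_of_ge2 m : (2 <= (rows_of 0 0 m).2) = has id (behead m).
Proof.
case: m => [|x m] //=; apply/idP/idP => [|hm].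
  by apply: contraLR => hm; case: x; rewrite /= rows_of_id.
by case: x; rewrite /=; [have := rows_of_gt 1 1 hm | have := rows_of_gt 2 0 hm].
Qed.

Lemma size_dominoes_of a b m : size (dominoes_of a b m) = size m.
Proof. by rewrite -[in RHS](map_domino_bit a b m) size_map. Qed.

Lemma strictly_below_dominoes_of a b m i :
    b <= a -> ~~ odd (a - b) -> i.+1 < size m ->
  strictly_below (nth (0, 0, false) (dominoes_of a b m) i.+1)
                 (nth (0, 0, false) (dominoes_of a b m) i) =
  ~~ nth false m i && nth false m i.+1.
Proof.
elim: m i a b => [|x [|y m] IH] // i a b leba ev lt_im.
case: i lt_im => [|i] lt_im; last first.
  have [leba' ev'] := next_rows_cases x leba ev.
  rewrite -[RHS](IH i (next_rows a b x).1 (next_rows a b x).2) //.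
  suff -> : dominoes_of a b [:: x, y & m] = next_domino a b x ::
    dominoes_of (next_rows a b x).1 (next_rows a b x).2 (y :: m) by [].
  by move=> /=; case: (next_rows a b x).
rewrite {lt_im IH} /= /next_rows /next_domino /strictly_below.
case: x => /=; last first.
  (* After a bit 0 the rows differ, so a following bit 1 is horizontal in row 1, hence strictly
     below. After a bit 1 row 1 is already met, so nothing lies strictly below. *)
  by rewrite (_ : (a.+2 == b) = false); [case: y | lia].
by case: (a =P b) => /= ?; case: y => //=; case: ifP.
Qed.

Lemma two_row_tableauE n (T : n.-tuple domino) : two_row_tableau T ->
  T = dominoes_of 0 0 (map domino_bit T) :> seq domino /\
  has id (behead (map domino_bit T)).
Proof.
case/existsP=> a /and3P[leba ge2 /and3P[_ pE /forallP ord]].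
have [||TE rE] := dominoes_of_bits (a := 0) (b := 0) (s := T) isT leba.
- by rewrite cats0.
- apply/(pairwiseP (0, 0, false)) => i j;
  rewrite !inE size_tuple => lti ltj ltij.
  have /forallP/(_ (Ordinal lti)) := ord (Ordinal ltj).
  rewrite !(tnth_nth (0, 0, false)) /no_box_before -val_eqE /= gtn_eqF //=.
  by apply: contraL => ->; rewrite -leqNgt ltnW.
by split=> //; rewrite -rows_of_ge2 -rE.
Qed.

Lemma dominoes_of_two_row_tableau n m : size m = n -> has id (behead m) ->
  exists2 T : n.-tuple domino, two_row_tableau T & map domino_bit T = m.
Proof.
move=> sm hm;
  have sT : size (dominoes_of 0 0 m) == n by rewrite size_dominoes_of sm.
exists (Tuple sT); last exact: map_domino_bit.
have [] := dominoes_of_young2 (a := 0) (b := 0) m isT isT.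
have := dominoes_of_pairwise (a := 0) (b := 0) m isT isT; move: hm;
  rewrite -rows_of_ge2.
case: (rows_of 0 0 m) => a b /= ge2 /(pairwiseP (0, 0, false)) pw leba _ sumab
  pE.
have lta : a < n.*2.+1 by lia.
have bE : n.*2 - a = b by lia.
apply/existsP; exists (Ordinal lta); rewrite /= bE leba ge2 /=; apply/and3P;
  split.
- by rewrite /is_partition_of /= leba !inE; lia.
- by rewrite cats0 in pE.
apply/forallP=> i; apply/forallP=> j; apply/implyP=> /andP[neij].
rewrite !(tnth_nth (0, 0, false)) /= => lr; rewrite ltnNge; apply/negP => leji.
have ltji : j < i by rewrite ltn_neqAle leji andbT eq_sym.
by have := pw j i _ _ ltji;
  rewrite /no_box_before lr !inE (eqP sT) !ltn_ord => /(_ isT isT).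
Qed.

Lemma des_tab_bits n (T : n.-tuple domino) :
  two_row_tableau T -> des_tab T = bit_descents n (map domino_bit T).
Proof.
case/two_row_tableauE; set m := map _ _ => TE _.
have sm : size m = n by rewrite size_map size_tuple.
apply/setP=> i; rewrite !inE /labelled TE.
case: i => -[|i] /= lti.
  by case: m sm {TE} => [|x m] /= sm; [rewrite -sm in lti | case: x].
by rewrite strictly_below_dominoes_of ?sm.
Qed.

(** * Signed permutations and their words *)

Lemma hyperoctP n (p : symm_perm n) :
  reflect (forall i, p (rev_ord i) = rev_ord (p i)) (p \in hyperoct n).
Proof. by rewrite inE; apply: (iffP forallP) => h i; apply/eqP. Qed.

Lemma size_word n (p : symm_perm n) : size (word p) = n.
Proof. by rewrite size_map size_iota. Qed.

Lemma sval_at0 n (p : symm_perm n) : p \in hyperoct n -> sval_at p 0 = 0%R.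
Proof.
move/hyperoctP/(_ (inord (n + 0))).
have -> : rev_ord (inord (n + 0)) = inord (n + 0) :> 'I_n.*2.+1.
  by apply/val_inj; rewrite /= !inordK; lia.
rewrite /sval_at; move: (p _) => x /(congr1 val) /=.
by have := ltn_ord x; lia.
Qed.

Lemma nth_word n (p : symm_perm n) i : p \in hyperoct n -> i <= n ->
  nth 0%R (0%R :: word p) i = sval_at p i.
Proof.
move=> hp; case: i => [|i] lein /=; first by rewrite sval_at0.
by rewrite (nth_map 0) ?size_iota // nth_iota.
Qed.

Lemma word_inj n : {in hyperoct n &, injective (@word n)}.
Proof.
move=> p q hp hq e.
have up (x : 'I_n.*2.+1) : n <= x -> p x = q x.
  move=> lenx; have := nth_word hp (i := x - n); rewrite e nth_word //;
    last first.
    by have := ltn_ord x; lia.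
  rewrite /sval_at subnKC // inord_val => h; apply/val_inj => /=.
  by have := ltn_ord x; lia.
apply/permP=> x; have [/up//|ltxn] := leqP n x.
rewrite -[x]rev_ordK (hyperoctP _ hp) (hyperoctP _ hq) up //=.
by lia.
Qed.

Lemma word_onto n (w : seq int) : perm_eq (map absz w) (iota 1 n) ->
  exists2 p : symm_perm n, p \in hyperoct n & word p = w.
Proof.
move=> pw;
  have sw : size w = n by rewrite -(size_map absz) (perm_size pw) size_iota.
pose W i : int := nth 0%R (0%R :: w) i.
have W0 : W 0 = 0%R by [].
have absW i : `|W i|%N = nth 0 (map absz (0%R :: w)) i.
  have [lti|gei] := ltnP i (size w).+1; first by rewrite (nth_map 0%R).
  by rewrite /W !nth_default //= size_map.
have uW : uniq (map absz (0%R :: w)).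
  by rewrite /= (perm_uniq pw) (perm_mem pw) mem_iota iota_uniq.
have W_inj i j : i <= n -> j <= n -> `|W i|%N = `|W j|%N -> i = j.
  by move=> lei lej; rewrite !absW => /eqP;
    rewrite nth_uniq ?size_map //= ?sw // => /eqP.
have W_le i : `|W i|%N <= n.
  rewrite absW; have [lti|gei] := ltnP i (size w).+1;
    last by rewrite nth_default //= size_map.
  have : nth 0 (map absz (0%R :: w)) i \in 0 :: iota 1 n.
    by rewrite inE -(perm_mem pw) -in_cons; apply: mem_nth; rewrite /= size_map.
  by rewrite inE mem_iota; lia.
(* The odd extension of [W], shifted by [n]; [absz] changes nothing since letters are at most [n] in
   absolute value. *)
pose q (x : 'I_n.*2.+1) : nat :=
  if n <= x then absz (Posz n + W (x - n)%N)%R else absz (Posz n - W (n -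
    x)%N)%R.
have lt_q x : q x < n.*2.+1.
  by rewrite /q; case: ifP => _; [have := W_le (x - n) | have := W_le (n - x)];
    clear; lia.
pose f x := Ordinal (lt_q x).
have f_inj : injective f.
  move=> x y /(congr1 val) /=; rewrite /q => e; apply/val_inj => /=.
  have := ltn_ord x; have := ltn_ord y.
  (* Opposite letters have the same absolute value, so they sit at the same index, where the letter
     equals its opposite and is 0. *)
  have mixed i j : (Posz n + W i = Posz n - W j)%R -> i <= n -> j <= n -> j = 0.
    move=> eW lei lej; have eij : i = j by apply: W_inj => //; move: eW; clear;
      lia.
    by rewrite -eij; apply: W_inj => //; move: eW; rewrite -eij W0; clear; lia.
  have abs_inj (u v : int) : `|u|%N <= n -> `|v|%N <= n ->
      absz (Posz n + u)%R = absz (Posz n + v)%R -> (Posz n + u = Posz n + v)%R.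
    by clear; lia.
  move: e; case: (leqP n x) => hx; case: (leqP n y) => hy e lty ltx.
  - move/abs_inj: e; rewrite !W_le => /(_ isT isT)/addrI/(congr1 absz)/W_inj.
    by move: hx hy ltx lty; clear; lia.
  - move/abs_inj: e; rewrite abszN !W_le => /(_ isT isT)/mixed.
    by move: hx hy ltx lty; clear; lia.
  - move/esym/abs_inj: e; rewrite abszN !W_le => /(_ isT isT)/mixed.
    by move: hx hy ltx lty; clear; lia.
  - move/abs_inj: e;
    rewrite !abszN !W_le => /(_ isT isT)/addrI/oppr_inj/(congr1 absz)/W_inj.
    by move: hx hy ltx lty; clear; lia.
have fE i : i <= n -> sval_at (perm f_inj) i = W i.
  move=> lei; rewrite /sval_at permE /= /q inordK; last by lia.
  by rewrite leq_addr addKn; have := W_le i; clear; lia.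
exists (perm f_inj).
  apply/hyperoctP => x; rewrite !permE; apply/val_inj => /=.
  rewrite /q /=; have := ltn_ord x => ltx.
  have := W_le (x - n); have := W_le (n - x).
  case: (ltngtP n x) ltx; clear -W0 => hx ltx.
  - rewrite ifN; last by lia.
    have -> : n - (n.*2.+1 - x.+1) = x - n by lia.
    by lia.
  - rewrite ifT; last by lia.
    have -> : n.*2.+1 - x.+1 - n = n - x by lia.
    by lia.
  - rewrite ifT; last by lia.
    have -> : n.*2.+1 - x.+1 - n = 0 by lia.
    by rewrite -hx subnn W0; lia.
apply: (@eq_from_nth _ 0%R); rewrite ?size_word ?sw // => i lti.
by rewrite (nth_map 0) ?size_iota // nth_iota // fE.
Qed.

(** * From sign words to the bijection *)

Definition negative : pred int := fun x => (x < 0)%R.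

Lemma nonconstant_count m : nonconstant m = (0 < count id m < size m).
Proof.
  by rewrite /nonconstant has_count all_count [_ < size m]ltn_neqAle count_size
    andbT. Qed.

(** With 0 counted among the nonnegative letters, neighbours of equal sign ascend, so a descent is
    exactly a passage from nonnegative to negative. *)
Lemma des_perm_bits n (p : symm_perm n) : p \in hyperoct n ->
  sorted <%R (filter negative (word p)) ->
  sorted <%R (0%R :: filter (predC negative) (word p)) ->
  des_perm p = bit_descents n (map negative (word p)).
Proof.
move=> hp sneg snonneg.
have
  := sorted_filter_same (w := 0%R :: word p) (P := negative) lt_trans sneg
    snonneg.
move/(sortedP 0%R) => adj; apply/setP=> i; rewrite !inE.
have lti : i < size (word p) by rewrite size_word.
rewrite -[false :: _]/(map negative (0%R :: word p)) (nth_map 0%R) /=;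
  last first.
  by rewrite ltnW.
rewrite (nth_map 0%R) // -!nth_word //; last exact: ltnW.
move: (adj i lti) => /=; rewrite /negative; case: ltP => hx; case: ltP => hy /=;
  lia.
Qed.

(* The index [j] of a shuffle is recovered from the number [s j] of its *)
(* negative letters, that is, of the bits equal to [true].              *)
Lemma shuffles_bijection (n : nat) (A : {set symm_perm n})
    (a b : nat -> seq int) (s : nat -> nat) :
  0 < n ->
  (forall j, 0 < j < n -> 0 < s j < n /\ s (s j) = j) ->
  (forall j, 0 < j < n ->
     [/\ size (a j) = s j, all negative (a j) & sorted <%R (a j)]) ->
  (forall j, 0 < j < n ->
     all (predC negative) (b j) /\ sorted <%R (0%R :: b j)) ->
  (forall j, 0 < j < n -> perm_eq (map absz (a j ++ b j)) (iota 1 n)) ->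
  (forall p, (p \in A) = (p \in hyperoct n) &&
     [exists k : 'I_n, (1 <= k) && shuffle (a k) (b k) (word p)]) ->
  descent_preserving_bijection A (@two_row_tableau n).
Proof.
move=> n_gt0 sP aP bP abP AP.
have shP j w : 0 < j < n -> shuffle (a j) (b j) w =
    (filter negative w == a j) && (filter (predC negative) w == b j).
  by move=> hj; apply: shuffle_filter;
    [have [] := aP j hj | have [] := bP j hj].
have wordP p : p \in A -> p \in hyperoct n /\ exists2 j, 0 < j < n &
    filter negative (word p) = a j /\ filter (predC negative) (word p) = b j.
  rewrite AP => /andP[hp /existsP[j /andP[j_gt0]]].
  have hj : 0 < j < n by rewrite j_gt0 ltn_ord.
  by rewrite shP // => /andP[/eqP ea /eqP eb]; split=> //; exists j.
pose bits (p : symm_perm n) := map negative (word p).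
have size_bits p : size (bits p) = n by rewrite size_map size_word.
have count_bits p j : 0 < j < n -> filter negative (word p) = a j ->
    count id (bits p) = s j.
  by move=> hj ea;
    rewrite count_map -size_filter -[filter _ _]/(filter negative _) ea; have []
      := aP j hj.
have bits_nc p : p \in A -> nonconstant (bits p).
  case/wordP=> _ [j hj [ea _]].
  by rewrite nonconstant_count size_bits (count_bits p j) //; have []
    := sP j hj.
have bits_inj : {in A &, injective bits}.
  move=> p q /wordP[hp [j hj [ea eb]]] /wordP[hq [k hk [ea' eb']]] e.
  have ejk : j = k.
    rewrite -[j](proj2 (sP j hj)) -[k](proj2 (sP k hk)).
    by rewrite -(count_bits p j) // e (count_bits q k).
  by apply: word_inj => //; apply: map_filter_inj e _ _; rewrite ?ea ?eb ejk.
have bits_onto m : size m = n -> nonconstant m -> exists2 p, p \in A & bits p =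
  m.
  move=> sm; rewrite nonconstant_count sm => hm.
  (* As [s] is an involution, [a j] has exactly as many letters as [m] has bits 1. *)
  pose j := s (count id m); have [hj sj] := sP _ hm.
  have [sa na _] := aP j hj; have [nb _] := bP j hj.
  have sb : size (b j) = count negb m.
    have := perm_size (abP j hj); rewrite size_map size_cat size_iota sa /j sj.
    by rewrite -sm -(count_predC id m) => /addnI->; apply: eq_count.
  have [|w [em ea eb]] := merge_by_mask na nb _ sb; first by rewrite sa.
  have [|p hp ew] := @word_onto n w.
    apply: perm_trans (abP j hj); apply: perm_map.
    by rewrite -ea -eb perm_sym; apply/permPl/perm_filterC.
  exists p; last by rewrite /bits ew.
  rewrite AP hp; apply/existsP; case/andP: (hj) => j_gt0 ltjn.
  by exists (Ordinal ltjn); rewrite j_gt0 shP // ew ea eb !eqxx.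
have bits_des p : p \in A -> des_perm p = bit_descents n (bits p).
  case/wordP=> hp [j hj [ea eb]]; have [_ _ sa] := aP j hj; have [_ sb]
    := bP j hj.
  by apply: des_perm_bits; rewrite ?ea ?eb.
(* Composing with [head_to_full] gives both codes the same image: the words with a bit 1 outside the
   head. *)
have [||x Ax|T BT|f [f_bij fE]]
  := @bijection_by_code _ _ _ (mem A) (@two_row_tableau n)
  (head_to_full \o bits) (map domino_bit).
- move=> p q Ap Aq /= /head_to_full_inj e.
  by apply: bits_inj => //; apply: e; exact: bits_nc.
- move=> T U /two_row_tableauE[TE _] /two_row_tableauE[UE _] e.
  by apply: val_inj; rewrite /= TE UE e.
- have [T BT TE]
  := dominoes_of_two_row_tableau (n := n) (m := head_to_full (bits x))
    (etrans (size_head_to_full _) (size_bits x)) (has_behead_head_to_full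
      (bits_nc x Ax)).
  by exists T.
- have [_ /head_to_full_onto[m ncm em]] := two_row_tableauE BT.
  have [|p Ap ep] := bits_onto m _ ncm; last by exists p; rewrite //= ep.
  by rewrite -size_head_to_full em size_map size_tuple.
exists f; split=> // p; rewrite (des_tab_bits (valP (f p))) fE /=.
by rewrite bit_descents_head_to_full ?size_bits // bits_des //; exact: valP p.
Qed.

(** * The runs of the arc permutations *)

Lemma size_neg_run i j : size (neg_run i j) = j.+1 - i.
Proof. by rewrite size_map size_rev size_iota. Qed.

Lemma neg_run_negative i j : 0 < i -> all negative (neg_run i j).
Proof.
move=> i_gt0; rewrite all_map all_rev; apply/allP => x.
by rewrite mem_index_iota /= /negative; lia.
Qed.

Lemma pos_run_nonnegative i j : all (predC negative) (pos_run i j).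
Proof. by rewrite all_map; apply/allP => x _ /=; rewrite /negative; lia. Qed.

Lemma neg_run_sorted i j : sorted <%R (neg_run i j).
Proof.
rewrite sorted_map rev_sorted.
by apply: sub_sorted (iota_ltn_sorted i (j.+1 - i)) => x y /=; lia.
Qed.

Lemma pos_run_sorted i j : 0 < i -> sorted <%R (0%R :: pos_run i j).
Proof.
move=> i_gt0; rewrite -[_ :: _]/(map Posz (0 :: index_iota i j.+1)) sorted_map.
apply: (@sub_sorted _ ltn) => [x y|] /=; first by lia.
rewrite (path_sortedE ltn_trans) iota_ltn_sorted andbT.
by apply/allP => x; rewrite mem_index_iota; lia.
Qed.

Lemma perm_abs_runs i j k l :
  perm_eq (map absz (neg_run i j ++ pos_run k l))
          (index_iota i j.+1 ++ index_iota k l.+1).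
Proof.
rewrite map_cat -!map_comp (eq_map (f := _ \o _) (g := id)); last first.
  by move=> x /=; rewrite abszN.
by rewrite map_id [map (_ \o _) _](@map_id_in) // perm_cat2r perm_rev.
Qed.

Lemma index_iota_split k n :
  k <= n -> index_iota 1 k.+1 ++ index_iota k.+1 n.+1 = iota 1 n.
Proof. by move=> lekn; rewrite /index_iota subSS subn0 subSS -iotaD subnKC. Qed.

Theorem proposition6 (n : nat) (hn : 1 <= n) :
  descent_preserving_bijection (type5_arc n) (@two_row_tableau n) /\
  descent_preserving_bijection (type6_arc n) (@two_row_tableau n).
Proof.
split.
  apply: (@shuffles_bijection _ _ (fun k => neg_run 1 k)
            (fun k => pos_run k.+1 n) id) => // [j hj|j hj|j hj|p].
  - by rewrite size_neg_run subn1 neg_run_negative // neg_run_sorted.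
  - by rewrite pos_run_nonnegative pos_run_sorted.
  - apply: perm_trans (perm_abs_runs _ _ _ _) _.
    by rewrite index_iota_split //; case/andP: hj => _ /ltnW.
  - by rewrite inE.
(* Here the negative letters are -n, ..., -(k+1), so there are n - k of them, and k ↦ n - k is its
   own inverse. *)
apply: (@shuffles_bijection _ _ (fun k => neg_run k.+1 n)
          (fun k => pos_run 1 k) (subn n)) => // [j hj|j hj|j hj|j hj|p].
- by split; lia.
- by rewrite size_neg_run subSS neg_run_negative // neg_run_sorted.
- by rewrite pos_run_nonnegative pos_run_sorted.
- apply: perm_trans (perm_abs_runs _ _ _ _) _.
  by rewrite perm_catC index_iota_split //; case/andP: hj => _ /ltnW.
- by rewrite inE.
Qed.
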